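(* For any function $f : \mathbb{N} \to \mathbb{N}$ there exist a residually finite group $B_f$ and a two-element generating set $X$ for $B_f$ such that $\mathrm{F}_{B_f, X}(n) \geq f(n)$ for all $n \geq 8$.
   Context: Here $\mathbb{N} = \{1,2,3,\ldots\}$. Let $\Gamma$ be a residually finite group generated by a finite set $X$. An element $\gamma \in \Gamma$ is detected by a finite quotient $Q$ of $\Gamma$ if there is a surjective homomorphism $\phi : \Gamma \to Q$ with $\gamma \notin \ker \phi$. The residual finiteness growth function $\mathrm{F}_{\Gamma, X} : \mathbb{N} \to \mathbb{N}$ is defined by letting $\mathrm{F}_{\Gamma,X}(n)$ be the minimal natural number $N$ such that every nontrivial element of $\Gamma$ of word length $\leq n$ with respect to $X$ (that is, expressible as a product of at most $n$ elements of $X \cup X^{-1}$) is detected by some finite quotient $Q$ of $\Gamma$ (which may depend on the element) of cardinality $\leq N$. *)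

(* Defs.v *)
From mathcomp Require Import all_boot all_fingroup finmap.
From mathcomp Require Import boolp classical_sets.

Set Implicit Arguments.
Unset Strict Implicit.
Unset Printing Implicit Defensive.

Local Open Scope group_scope.

Definition word_length_le (G : groupType) (X : {fset G}) (n : nat) (g : G) :=
  exists s : seq G,
    [/\ (size s <= n)%N,
        forall x, x \in s -> (x \in X) || (x^-1 \in X)
      & g = \prod_(x <- s) x].

Definition generates (G : groupType) (X : {fset G}) :=
  forall g : G, exists n, word_length_le X n g.

Definition detected_by (G : groupType) (g : G) (Q : finGroupType) :=
  exists phi : {multiplicative G -> Q},
    (forall q : Q, exists h : G, phi h = q) /\ phi g <> 1.

Definition residually_finite (G : groupType) :=
  forall g : G, g <> 1 -> exists Q : finGroupType, detected_by g Q.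

(* Bounds are required to be positive, so that the minimal one is taken in    *)
(* {1, 2, 3, ...} even when no nontrivial element has length at most n.       *)
Definition rf_bound (G : groupType) (X : {fset G}) (n N : nat) :=
  (0 < N)%N /\
  forall g : G, g <> 1 -> word_length_le X n g ->
    exists Q : finGroupType, (#|Q| <= N)%N /\ detected_by g Q.

Definition is_rf_growth (G : groupType) (X : {fset G}) (n N : nat) :=
  rf_bound X n N /\ forall M, rf_bound X n M -> (N <= M)%N.

(* The residual finiteness growth function.  The default value 0 is never     *)
(* reached when G is residually finite: see rf_growthP.                       *)
Definition rf_growth (G : groupType) (X : {fset G}) (n : nat) : nat :=
  xget 0%N [set N | is_rf_growth X n N]%classic.

Lemma finite_ball (G : groupType) (X : {fset G}) (n : nat) :
  exists B : seq G, forall g, word_length_le X n g -> g \in B.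
Proof.
elim: n => [|n [B hB]].
  by exists [:: 1] => g [[|x s] [les _ ->]]; rewrite ?big_nil ?inE.
pose S : seq G := X ++ [seq x^-1 | x <- X].
exists (1 :: [seq x * b | x <- S, b <- B]) => g [[|x s] [les sX ->]].
  by rewrite big_nil inE eqxx.
rewrite big_cons inE; apply/orP; right; apply: allpairs_f.
  rewrite mem_cat; have /orP[->//|xX] := sX x (mem_head _ _).
  by apply/orP; right; rewrite -[x]invgK map_f.
apply: hB; exists s; split=> // y ys; apply: sX.
by rewrite inE ys orbT.
Qed.

Lemma rf_growthP (G : groupType) (X : {fset G}) (n : nat) :
  residually_finite G -> is_rf_growth X n (rf_growth X n).
Proof.
move=> rfG; have [B hB] := finite_ball X n.
have {hB} [N hN] : exists N, rf_bound X n N.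
  suff [N N0 hN] : exists2 N, (0 < N)%N & forall g, g <> 1 -> g \in B ->
      exists Q : finGroupType, (#|Q| <= N)%N /\ detected_by g Q.
    by exists N; split=> // g g1 /hB; apply: hN.
  elim: B {hB} => [|b B [N N0 hN]]; first by exists 1%N.
  have [b1|/rfG [Q bQ]] := pselect (b = 1).
    by exists N => // g g1; rewrite inE => /predU1P[gb|]; [case: g1; rewrite gb|exact: hN].
  exists (maxn N #|Q|) => [|g g1]; first by rewrite leq_max N0.
  rewrite inE => /predU1P[->|/(hN _ g1)[Q' [le' dQ']]].
    by exists Q; rewrite leq_maxr.
  by exists Q'; split=> //; rewrite leq_max le'.
have exP : exists N, `[< rf_bound X n N >] by exists N; apply/asboolP.
rewrite /rf_growth; apply: (@xgetPex _ 0%N [set M | is_rf_growth X n M]%classic).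
case: (ex_minnP exP) => M /asboolP hM minM; exists M; split=> // K hK.
by apply: minM; apply/asboolP.
Qed.

(* Main.v *)
(* The group is generated by the sequences x = (x_k) and y = (y_k) in a       *)
(* product of finite groups G_k.  With m_k = 3^(k+1+N_k), G_k is an extension *)
(* by <x_k> = Z/m_k of a central extension of (Z/2)^m_k by Z/2 in which the   *)
(* conjugates y_(k,i) of y_k by x_k^i commute, except that y_(k,a) and        *)
(* y_(k,b) do not if b - a = 3^k or -3^k modulo m_k.  By comparing 3-adic     *)
(* valuations, [y, y^(x^(3^k))], of length 4 * 3^k + 4, is nontrivial only in *)
(* G_k; and for the multiples i of 3^(k+1), a quotient in which it survives   *)
(* separates the conjugates of y by x^i which are distinct modulo m_k, hence  *)
(* has at least 3^N_k > N_k elements, where N_k is arbitrary.                 *)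
Require Import Defs.
From HB Require Import structures.
From mathcomp Require Import all_boot all_fingroup all_algebra finmap.
From mathcomp Require Import boolp zify.

Set Implicit Arguments.
Unset Strict Implicit.
Unset Printing Implicit Defensive.

Import GRing.Theory.

Local Open Scope group_scope.

(** A subgroup of a product of finite groups is residually finite, so it suffices to find short
    elements that are expensive to detect. In the subgroup generated by x and y, write y_i for y
    conjugated by x^i. Let i and l be multiples of 3^(k+1) that differ modulo m_k. Then y_l commutes
    with y_(i+3^k) in every factor ([commute_flip_at]), whereas y_i does not in the k-th one. A
    homomorphism that identifies y_i with y_l therefore kills [y_i, y_(i+3^k)], a conjugate of
    [witness k]. So a quotient detecting this witness separates all these y_i ([card_detecting]).
    Its order is thus at least [bound k], which is chosen freely, while the length of the witness
    does not depend on that choice. *)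

(** * Word length of products, powers, conjugates and commutators *)

Section WordLength.
Variables (G : groupType) (X : {fset G}).
Implicit Types (g h : G) (m n : nat).

Lemma word_length_le1 n : word_length_le X n 1.
Proof. by exists [::]; split=> //; rewrite big_nil. Qed.

Lemma word_length_le_gen g : g \in X -> word_length_le X 1 g.
Proof.
move=> gX; exists [:: g]; split=> // [x|]; last by rewrite big_seq1.
by rewrite inE => /eqP->; rewrite gX.
Qed.

Lemma word_length_leW m n g :
  (m <= n)%N -> word_length_le X m g -> word_length_le X n g.
Proof.
by move=> mn [s [sm sX ->]]; exists s; split=> //; apply: leq_trans mn.
Qed.

Lemma word_length_leM m n g h :
  word_length_le X m g -> word_length_le X n h ->
  word_length_le X (m + n) (g * h).
Proof.
move=> [s [sm sX ->]] [t [tn tX ->]]; exists (s ++ t); split.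
- by rewrite size_cat leq_add.
- by move=> x; rewrite mem_cat => /orP[/sX|/tX].
- by rewrite big_cat.
Qed.

Lemma word_length_leV n g : word_length_le X n g -> word_length_le X n g^-1.
Proof.
move=> [s [sn sX ->]]; exists (rev [seq x^-1 | x <- s]); split.
- by rewrite size_rev size_map.
- by move=> _ /[!mem_rev]/mapP[x xs ->]; rewrite invgK orbC sX.
- elim: s {sn sX} => [|x s IHs]; first by rewrite !big_nil invg1.
  by rewrite big_cons invgM IHs map_cons rev_cons -cats1 big_cat big_seq1.
Qed.

Lemma word_length_leX m n g :
  word_length_le X m g -> word_length_le X (n * m) (g ^+ n).
Proof.
move=> gm; elim: n => [|n IHn]; first exact: word_length_le1.
by rewrite expgS mulSn; apply: word_length_leM.
Qed.

Lemma word_length_leJ m n g h :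
  word_length_le X m g -> word_length_le X n h ->
  word_length_le X (n + (m + n)) (g ^ h).
Proof.
by move=> ? hn; do 2?apply: word_length_leM => //; apply: word_length_leV.
Qed.

Lemma word_length_leR m n g h :
  word_length_le X m g -> word_length_le X n h ->
  word_length_le X (m + (n + (m + n))) [~ g, h].
Proof.
by move=> ? ?; do 3?apply: word_length_leM => //; apply: word_length_leV.
Qed.

End WordLength.

(** * The subgroup generated by a finite set, as a group in its own right *)

Section GeneratedSubgroup.
Variables (G : groupType) (X : {fset G}).

Definition word_span : {pred G} :=
  [pred g | `[< exists n, word_length_le X n g >]].

Lemma word_span_group_closed : group_closed word_span.
Proof.
split=> [|g h /asboolP[m gm] /asboolP[n hn]]; apply/asboolP.
  by exists 0; apply: word_length_le1.
by exists (m + n); apply/word_length_leM/word_length_leV.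
Qed.

Record word_group := WordGroup {
  word_group_val :> G;
  word_group_valP : word_group_val \in word_span
}.

HB.instance Definition _ := [isSub for word_group_val].
HB.instance Definition _ := [Choice of word_group by <:].
HB.instance Definition _ :=
  SubChoice_isSubGroup.Build G word_span word_group word_span_group_closed.

Definition word_group_gens : {fset word_group} :=
  [fset u in pmap (fun g => insub g : option word_group) (enum_fset X)]%fset.

Lemma word_group_gensE (u : word_group) :
  (u \in word_group_gens) = (word_group_val u \in X).
Proof.
rewrite !inE /= mem_pmap; apply/mapP/idP => [[g gX uE]|uX].
  by move: gX; case: (insubP _ g) uE => // v _ <- [->].
by exists (word_group_val u) => //; rewrite [RHS](valK u).
Qed.

Lemma word_group_generated : generates word_group_gens.
Proof.
suff H s (u : word_group) : (forall x, x \in s -> (x \in X) || (x^-1 \in X)) ->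
    word_group_val u = \prod_(x <- s) x ->
    word_length_le word_group_gens (size s) u.
  move=> u; have /asboolP[n [s [_ sX us]]] := word_group_valP u.
  by exists (size s); apply: H.
elim: s u => [|x s IHs] u sX us.
  rewrite big_nil in us; have -> : u = 1 by apply: val_inj.
  exact: word_length_le1.
have xX := sX x (mem_head _ _).
have xP : x \in word_span.
  apply/asboolP; exists 1%N; case/orP: xX => [/word_length_le_gen//|].
  by move/word_length_le_gen/word_length_leV; rewrite invgK.
pose v := WordGroup xP.
rewrite -[u](mulVKg v); apply: (@word_length_leM _ _ 1).
  case/orP: xX => [xX|xVX].
    by apply: word_length_le_gen; rewrite word_group_gensE.
  rewrite -[v]invgK; apply/word_length_leV/word_length_le_gen.
  by rewrite word_group_gensE.
apply: IHs => [z zs|]; first by apply: sX; rewrite inE zs orbT.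
by rewrite [LHS]/= [X in X^-1 * _]/= us big_cons mulKg.
Qed.

End GeneratedSubgroup.

(** * Unrestricted direct products *)

Section PointwiseGroup.
Variables (I : Type) (G : I -> groupType).
Implicit Types f g h : forall i, G i.

Definition pointwise_one i : G i := 1.
Definition pointwise_inv f i := (f i)^-1.
Definition pointwise_mul f g i := f i * g i.

Fact pointwise_mulA : associative pointwise_mul.
Proof.
by move=> f g h; apply: functional_extensionality_dep => i; apply: mulgA.
Qed.

Fact pointwise_mul1 : left_id pointwise_one pointwise_mul.
Proof.
by move=> f; apply: functional_extensionality_dep => i; apply: mul1g.
Qed.

Fact pointwise_mulr1 : right_id pointwise_one pointwise_mul.
Proof.
by move=> f; apply: functional_extensionality_dep => i; apply: mulg1.
Qed.

Fact pointwise_mulV : left_inverse pointwise_one pointwise_inv pointwise_mul.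
Proof.
by move=> f; apply: functional_extensionality_dep => i; apply: mulVg.
Qed.

Fact pointwise_mulrV : right_inverse pointwise_one pointwise_inv pointwise_mul.
Proof.
by move=> f; apply: functional_extensionality_dep => i; apply: mulgV.
Qed.

HB.instance Definition _ := isGroup.Build (forall i, G i) pointwise_mulA
  pointwise_mul1 pointwise_mulr1 pointwise_mulV pointwise_mulrV.

End PointwiseGroup.

(** * Detection by homomorphisms to finite groups, made surjective by restricting to the image *)

Section FiniteImage.
Variables (G : groupType) (Q : finGroupType) (f : {multiplicative G -> Q}).

Lemma multiplicative1 : f 1 = 1.
Proof. by apply: (mulgI (f 1)); rewrite -gmulfM !mulg1. Qed.

Definition finite_image := [set q : Q | `[< exists g, f g = q >]].

Lemma finite_image_group_set : group_set finite_image.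
Proof.
apply/group_setP; split=> [|p q]; rewrite !inE.
  by apply/asboolP; exists 1; apply: multiplicative1.
move=> /asboolP[g <-] /asboolP[h <-]; apply/asboolP; exists (g * h).
exact: gmulfM.
Qed.
Canonical finite_image_group := Group finite_image_group_set.

Lemma mem_finite_image g : f g \in finite_image_group.
Proof. by rewrite inE; apply/asboolP; exists g. Qed.

Definition to_finite_image g : subg_of finite_image_group :=
  Subg (mem_finite_image g).

Fact to_finite_imageM : {morph to_finite_image : g h / g * h}.
Proof. by move=> g h; apply: val_inj; rewrite /= gmulfM. Qed.
HB.instance Definition _ := isMultiplicative.Build G
  (subg_of finite_image_group) to_finite_image to_finite_imageM.

Lemma detected_by_finite_image g :
  f g <> 1 -> exists Q' : finGroupType, detected_by g Q'.
Proof.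
move=> fg1; exists (subg_of finite_image_group), to_finite_image; split.
  move=> [q qf]; have := qf; rewrite inE => /asboolP[h hq].
  by exists h; apply: val_inj.
by move=> /(congr1 val).
Qed.
End FiniteImage.

(** * The finite factors, as permutation groups *)

Section Shift.
Variables (m : nat) (j : 'Z_m).
Implicit Types (a b : 'Z_m) (p q : {set 'Z_m} * bool).

Definition shift_fun p := ([set i | (i - 1)%R \in p.1], p.2).

Lemma shift_fun_inj : injective shift_fun.
Proof.
move=> [v c] [w d] [/setP vw ->]; congr pair; apply/setP => i.
by have := vw (i + 1)%R; rewrite !inE addrK.
Qed.

Definition shift := perm shift_fun_inj.

(* In the central extension of (Z/2)^m by Z/2 with cocycle the bilinear form  *)
(* beta(e_a, e_b) = [b = a + j], this is right translation by (e_a, 0), a     *)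
(* vector of (Z/2)^m being encoded by its support.                            *)
Definition flip_fun a p :=
  ([set i | (i \in p.1) (+) (i == a)], p.2 (+) ((a - j)%R \in p.1)).

Lemma flip_fun_inj a : injective (flip_fun a).
Proof.
move=> [v c] [w d] [/setP vw /= cd].
have {}vw : v = w by apply/setP => i; have := vw i; rewrite !inE => /addIb.
by congr pair; move: cd; rewrite vw => /addIb.
Qed.

Definition flip a := perm (@flip_fun_inj a).

Lemma flipJ_shift a : flip a ^ shift = flip (a + 1)%R.
Proof.
apply: (mulgI shift); rewrite -conjgC; apply/permP => -[v c].
rewrite !permM !permE /flip_fun /shift_fun /= !inE.
congr pair; last by rewrite addrAC addrK.
by apply/setP => i; rewrite !inE subr_eq.
Qed.

Lemma flipJ_shiftX a n : flip a ^ (shift ^+ n) = flip (a + n%:R)%R.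
Proof.
elim: n => [|n IHn]; first by rewrite conjg1 addr0.
by rewrite expgSr conjgM IHn flipJ_shift -addrA natr1.
Qed.

(** The commutator of the two translations is the central element beta(e_a, e_b) - beta(e_b, e_a).
    Evaluating both products at [(set0, false)] already reveals it. *)
Lemma commute_flip a b :
  commute (flip a) (flip b) <-> ((b == a + j) = (a == b + j))%R.
Proof.
have E a' b' p : (flip a' * flip b') p =
  ([set i | (i \in p.1) (+) (i == a') (+) (i == b')],
   p.2 (+) ((a' - j)%R \in p.1) (+) ((b' - j)%R \in p.1) (+) (b' == a' + j)%R).
  rewrite permM !permE /flip_fun /= !inE addbA subr_eq; congr pair.
  by apply/setP => i; rewrite !inE.
split=> [/permP/(_ (set0, false))|ab]; first by rewrite !E !inE => -[].
apply/permP => p; rewrite !E ab; congr pair; last by congr addb; rewrite addbAC.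
by apply/setP => i; rewrite !inE addbAC.
Qed.

End Shift.

Lemma natr_Zp_eq m a b :
  (1 < m)%N -> (a%:R == b%:R :> 'Z_m)%R = (a == b %[mod m]).
Proof. by move=> m1; rewrite -val_eqE /= !val_Zp_nat. Qed.

Lemma dvdn_modP d n a b : d %| n -> a = b %[mod n] -> (d %| a) = (d %| b).
Proof. by move=> dn ab; rewrite /dvdn -(modn_dvdm a dn) ab modn_dvdm. Qed.

(** * Separation of the factors by 3-adic valuations *)

Section ThreeAdic.
Variables (k k' t i l : nat).
Hypotheses (k't : (k' < t)%N) (ki : 3 ^ k.+1 %| i) (kl : 3 ^ k.+1 %| l).

Let pow_ndvd n : (3 ^ n.+1 %| 3 ^ n) = false.
Proof. by rewrite dvdn_Pexp2l // ltnn. Qed.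

Let low : (k' < k)%N ->
  [/\ 3 ^ k'.+1 %| i, 3 ^ k'.+1 %| l & 3 ^ k'.+1 %| 3 ^ k].
Proof.
move=> k'k; split; last exact: dvdn_exp2l.
  by apply: dvdn_trans ki; apply: dvdn_exp2l; apply: leqW.
by apply: dvdn_trans kl; apply: dvdn_exp2l; apply: leqW.
Qed.

Let high : (k < k')%N -> 3 ^ k.+1 %| 3 ^ k' /\ 3 ^ k.+1 %| 3 ^ t.
Proof.
by move=> kk'; split; apply: dvdn_exp2l => //; apply: leq_trans (ltnW k't).
Qed.

(** If k and k' differ, then modulo 3^(min(k, k')+1) all terms vanish except the smaller of the two
    powers. *)
Lemma three_adic_sep : i + 3 ^ k = l + 3 ^ k' %[mod 3 ^ t] -> k = k'.
Proof.
have [/low[di dl dk]|/high[dk' dt]|//] := ltngtP k' k.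
  move/(dvdn_modP (dvdn_exp2l _ k't)).
  by rewrite dvdn_addr // dk dvdn_addr // pow_ndvd.
by move/(dvdn_modP dt); rewrite dvdn_addr // pow_ndvd dvdn_addr // dk'.
Qed.

(** The same reduction applies when k and k' differ. When k = k', it uses that 3 is odd: 2 * 3^k is
    not divisible by 3^(k+1). *)
Lemma three_adic_opp : l <> i + 3 ^ k + 3 ^ k' %[mod 3 ^ t].
Proof.
have [/low[di dl dk]|/high[dk' dt]|kk'] := ltngtP k' k.
- move/(dvdn_modP (dvdn_exp2l _ k't)).
  by rewrite dl dvdn_addr ?dvdn_add // pow_ndvd.
- by move/(dvdn_modP dt); rewrite kl dvdn_addl // dvdn_addr // pow_ndvd.
- move/(dvdn_modP (dvdn_exp2l _ k't)).
  rewrite kk' kl -addnA dvdn_addr // addnn -mul2n Gauss_dvdr ?pow_ndvd //.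
  by rewrite coprimeXl.
Qed.

End ThreeAdic.

Lemma gmulf_commg1 (G Q : groupType)
    (phi : {multiplicative G -> Q}) (g h u : G) :
  phi g = phi h -> commute h u -> phi [~ g, u] = 1.
Proof.
move=> gh hu; apply: (mulgI (phi (u * g))); rewrite -gmulfM -commgC mulg1.
by rewrite !gmulfM gh -!gmulfM hu.
Qed.

(** * The two-generator group and its witnesses *)

Section Construction.
Variable f : nat -> nat.

(* The witness of index k serves all lengths n < 4 * 3^(k+1) + 4, after which *)
(* the next one becomes short enough.                                         *)
Definition bound k := (\sum_(n < 4 * 3 ^ k.+1 + 4) f n)%N.
(** The surplus [bound k] in the exponent leaves 3^(bound k) multiples of 3^(k+1) distinct modulo
    [modulus k]. *)
Definition modulus k := (3 ^ (k.+1 + bound k))%N.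

Lemma modulus_gt1 k : (1 < modulus k)%N.
Proof. by rewrite -[1%N](expn0 3) ltn_exp2l. Qed.

Definition factor k : groupType := {perm {set 'Z_(modulus k)} * bool}.
Definition product : groupType := forall k, factor k.
Definition shifts : product := fun k => shift (modulus k).
Definition flips : product :=
  fun k => flip (3 ^ k)%N%:R%R (0%R : 'Z_(modulus k)).
Definition factor_gens : {fset product} := [fset shifts; flips]%fset.

Lemma shifts_span : shifts \in word_span factor_gens.
Proof.
by apply/asboolP; exists 1%N; apply: word_length_le_gen; rewrite !inE eqxx.
Qed.

Lemma flips_span : flips \in word_span factor_gens.
Proof.
apply/asboolP; exists 1%N; apply: word_length_le_gen.
by rewrite !inE eqxx orbT.
Qed.

Definition shift_gen : word_group factor_gens := WordGroup shifts_span.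
Definition flip_gen : word_group factor_gens := WordGroup flips_span.
Definition flip_at n := flip_gen ^ (shift_gen ^+ n).

Definition coord k (u : word_group factor_gens) : factor k :=
  word_group_val u k.
HB.instance Definition _ k :=
  isUMagmaMorphism.Build (word_group factor_gens) (factor k) (coord k)
    (erefl, fun u v => erefl).

Lemma coord_inj u v : (forall k, coord k u = coord k v) -> u = v.
Proof. by move=> uv; apply: val_inj; apply: functional_extensionality_dep. Qed.

Lemma coord_flip_at k n :
  coord k (flip_at n) = flip (3 ^ k)%N%:R%R (n%:R : 'Z_(modulus k))%R.
Proof.
rewrite gmulfJ gmulfXn; apply: etrans (flipJ_shiftX _ _ _) _.
by rewrite add0r.
Qed.

Lemma coord_flip_atM k n n' :
  coord k (flip_at n * flip_at n') =
    flip (3 ^ k)%N%:R%R (n%:R : 'Z_(modulus k))%R *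
    flip (3 ^ k)%N%:R%R (n'%:R : 'Z_(modulus k))%R.
Proof. by rewrite -!coord_flip_at. Qed.

Lemma residually_finite_word_group : residually_finite (word_group factor_gens).
Proof.
move=> u u1; have [/coord_inj//|/existsNP[k uk]] :=
  pselect (forall k, coord k u = coord k 1).
exact: (@detected_by_finite_image _ _ (coord k)).
Qed.

Lemma shift_gen_neq : shift_gen != flip_gen.
Proof.
apply/eqP => /(congr1 (coord 0)) /permP/(_ (set0, false)).
by rewrite !permE => -[/setP/(_ 0%R)]; rewrite !inE.
Qed.

Lemma factor_gensE :
  word_group_gens factor_gens = [fset shift_gen; flip_gen]%fset.
Proof. by apply/fsetP => u; rewrite word_group_gensE !inE. Qed.

(** In factor k', noncommutation needs an index difference 3^k' or -3^k'. The first forces k' = k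
    and then i = l modulo [modulus k]; the second never occurs. *)
Lemma commute_flip_at k i l : 3 ^ k.+1 %| i -> 3 ^ k.+1 %| l ->
  i <> l %[mod modulus k] -> commute (flip_at l) (flip_at (i + 3 ^ k)%N).
Proof.
move=> ki kl il; apply: coord_inj => k'; rewrite !coord_flip_atM.
apply/commute_flip; rewrite -!natrD !natr_Zp_eq ?modulus_gt1 //.
have k't : (k' < k'.+1 + bound k')%N by rewrite leq_addr.
transitivity false; last first.
  by apply/esym/negbTE/eqP/(three_adic_opp k't ki kl).
apply/negbTE/eqP => e; have kk' := three_adic_sep k't ki kl e.
by move/eqP: e; rewrite -kk' eqn_modDr => /eqP.
Qed.

Definition witness k := [~ flip_gen, flip_at (3 ^ k)%N].

(** In factor k the indices 0 and 3^k differ by exactly 3^k, and 0 is not 3^k + 3^k there. *)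
Lemma witness_neq1 k : witness k <> 1.
Proof.
move=> w1; have /(congr1 (coord k)) :
    flip_gen * flip_at (3 ^ k)%N = flip_at (3 ^ k)%N * flip_gen.
  by rewrite commgC -/(witness k) w1 mulg1.
rewrite -[flip_gen]conjg1 -[1](expg0 shift_gen) -/(flip_at 0).
rewrite !coord_flip_atM => /commute_flip.
rewrite -!natrD !natr_Zp_eq ?modulus_gt1 // eqxx => /esym/eqP e.
have k't : (k < k.+1 + bound k)%N by rewrite leq_addr.
by apply: (@three_adic_opp k k _ 0 0 k't); rewrite ?dvdn0 // add0n.
Qed.

Lemma word_length_witness k :
  word_length_le (word_group_gens factor_gens) (4 * 3 ^ k + 4)%N (witness k).
Proof.
have shift1 : word_length_le (word_group_gens factor_gens) 1 shift_gen.
  by apply: word_length_le_gen; rewrite factor_gensE !inE eqxx.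
have flip1 : word_length_le (word_group_gens factor_gens) 1 flip_gen.
  by apply: word_length_le_gen; rewrite factor_gensE !inE eqxx orbT.
have := word_length_leR flip1
  (word_length_leJ flip1 (word_length_leX (3 ^ k)%N shift1)).
apply: word_length_leW; rewrite muln1 !addnA; lia.
Qed.

Lemma commg_flip_at i n :
  [~ flip_at i, flip_at (i + n)%N] = [~ flip_gen, flip_at n] ^ (shift_gen ^+ i).
Proof. by rewrite conjRg /flip_at -conjgM -expgnDr addnC. Qed.

(* If phi identifies flip_at i and flip_at l, where 3^(k+1) divides i and l,  *)
(* it kills the commutator of flip_at i and flip_at (i + 3^k), a conjugate of *)
(* the witness, because flip_at l commutes with flip_at (i + 3^k).            *)
Lemma card_detecting k (Q : finGroupType) :
  detected_by (witness k) Q -> (bound k <= #|Q|)%N.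
Proof.
move=> [phi [_ phiw]].
pose h (s : 'I_(bound k)) := phi (flip_at (3 ^ k.+1 * s)%N).
rewrite -[bound k]card_ord; apply: (@leq_card _ _ h) => s r hsr.
apply/eqP; apply: contra_notT phiw => sr.
have : phi (witness k ^ shift_gen ^+ (3 ^ k.+1 * s)%N) = 1.
  rewrite -commg_flip_at; apply: gmulf_commg1 hsr _.
  apply: commute_flip_at; rewrite ?dvdn_mulr //.
  (* Being below the modulus, these multiples are distinct residues: q < [bound k] < 3^(bound k). *)
  have lt (q : 'I_(bound k)) : (3 ^ k.+1 * q < modulus k)%N.
    rewrite /modulus expnD ltn_pmul2l ?expn_gt0 //.
    by apply: ltn_trans (ltn_ord q) (ltn_expl _ _).
  rewrite !modn_small //; apply/eqP; rewrite eqn_pmul2l ?expn_gt0 //.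
move: (shift_gen ^+ _) => v wv; apply: (mulIg (phi v)).
by rewrite -gmulfM conjgC gmulfM wv mulg1 mul1g.
Qed.

End Construction.

Local Close Scope group_scope.

Theorem theorem1 (f : nat -> nat) :
  exists (B : groupType) (X : {fset B}),
    [/\ residually_finite B,
        #|` X|%fset = 2,
        generates X
      & forall n : nat, 8 <= n -> f n <= rf_growth X n].
Proof.
exists (word_group (factor_gens f)), (word_group_gens (factor_gens f)); split.
- exact: residually_finite_word_group.
- by rewrite factor_gensE cardfs2 shift_gen_neq.
- exact: word_group_generated.
move=> n n8.
(* The index k is the one with 4 * 3^k + 4 <= n < 4 * 3^(k+1) + 4; it exists because n >= 8 = 4 *
   3^0 + 4. The lower bound makes the witness short enough, the upper one makes [f n] a summand of
   [bound k]. *)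
have [[_ /(_ (witness f (trunc_log 3 ((n - 4)%N %/ 4))))]] :=
  rf_growthP (word_group_gens (factor_gens f)) n
    (@residually_finite_word_group f).
set k := trunc_log _ _.
have /andP[lo hi] := @trunc_log_bounds 3 ((n - 4)%N %/ 4) isT ltac:(lia).
rewrite -/k in lo hi.
case=> [||Q [QN /card_detecting kQ] _]; first exact: witness_neq1.
  by apply: word_length_leW (word_length_witness _ _); lia.
apply: leq_trans QN; apply: leq_trans kQ.
have nk : (n < 4 * 3 ^ k.+1 + 4)%N by lia.
by rewrite /bound (bigD1 (Ordinal nk)) //= leq_addr.
Qed.
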